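(* For any given real $a>0$ there exists a totally bounded metric space $X$ such that $\mathrm{H}_1(\mathrm{Rips}(X,a^{-}))$ has infinite dimension.
   Context: $\mathrm{H}_1$ is simplicial homology with coefficients in a fixed field $\mathbf{k}$; dimension is over $\mathbf{k}$. For a metric space $(X,d_X)$ and $a\in\mathbf{R}$, the open Vietoris--Rips complex $\mathrm{Rips}(X,a^-)$ is the simplicial complex whose simplices are the nonempty finite subsets $\{x_0,\dots,x_k\}\subseteq X$ with $d_X(x_i,x_j)<a$ for all $i,j$. A metric space is totally bounded if for every $\varepsilon>0$ it has a finite subset $F$ such that every point is at distance $<\varepsilon$ from some point of $F$. *)

(* Defs.v *)
From HB Require Import structures.
From mathcomp Require Import all_boot all_order all_fingroup all_algebra.
From mathcomp Require Import generic_quotient ring_quotient finmap.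
From mathcomp Require Import all_classical reals topology.

Set Implicit Arguments.
Unset Strict Implicit.
Unset Printing Implicit Defensive.

Import GRing.Theory.

Local Open Scope classical_set_scope.
Local Open Scope ring_scope.
Local Open Scope quotient_scope.

Section FiniteDimension.
Context (K : fieldType) (V : lmodType K).

Definition finite_dimensional : Prop :=
  exists (n : nat) (e : 'I_n -> V),
    forall v : V, exists a : 'I_n -> K, v = \sum_(i < n) a i *: e i.

Definition infinite_dimensional : Prop := ~ finite_dimensional.

End FiniteDimension.

(* MathComp's {quot I} only carries a zmodType structure.                     *)
Section QuotientModule.
Context (K : fieldType) (V : lmodType K) (I : submodClosed V).

Definition submod_pred : V -> bool := fun x => x \in I.

Fact submod_pred_zmod_closed : zmod_closed submod_pred.
Proof. exact: GRing.submod_closedB (GRing.submodClosedP I). Qed.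

HB.instance Definition _ :=
  GRing.isZmodClosed.Build V submod_pred submod_pred_zmod_closed.

Definition lmod_quot :=
  Quotient.quot (GRing.ZmodClosed.clone V submod_pred _).

HB.instance Definition _ := EqQuotient.on lmod_quot.
HB.instance Definition _ := GRing.Zmodule.on lmod_quot.

Lemma lmod_quot_eq (x y : V) : (\pi_lmod_quot x == \pi y) = (x - y \in I).
Proof. exact/esym/(Quotient.idealrBE (GRing.ZmodClosed.clone V submod_pred _)). Qed.

Lemma lmod_quotD (x y : V) : \pi_lmod_quot (x + y) = \pi x + \pi y.
Proof. exact: Quotient.pi_add. Qed.

Definition lmod_quot_scale (a : K) (q : lmod_quot) : lmod_quot :=
  \pi_lmod_quot (a *: repr q).

Lemma lmod_quotZ (a : K) (x : V) :
  \pi_lmod_quot (a *: x) = lmod_quot_scale a (\pi x).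
Proof.
apply/eqP; rewrite lmod_quot_eq -scalerBr rpredZ//.
by rewrite -lmod_quot_eq reprK.
Qed.

Fact lmod_quot_scalerA a b q :
  lmod_quot_scale a (lmod_quot_scale b q) = lmod_quot_scale (a * b) q.
Proof. by rewrite -[q]reprK -(lmod_quotZ b) -!lmod_quotZ scalerA. Qed.

Fact lmod_quot_scale1r : left_id 1 lmod_quot_scale.
Proof. by move=> q; rewrite -[q]reprK -lmod_quotZ scale1r. Qed.

Fact lmod_quot_scalerDr : right_distributive lmod_quot_scale +%R.
Proof.
move=> a p q; rewrite -[p]reprK -[q]reprK -lmod_quotD -!lmod_quotZ.
by rewrite scalerDr lmod_quotD.
Qed.

Fact lmod_quot_scalerDl q :
  {morph lmod_quot_scale^~ q : a b / a + b >-> a + b}.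
Proof.
by move=> a b /=; rewrite -[q]reprK -!lmod_quotZ scalerDl lmod_quotD.
Qed.

HB.instance Definition _ := GRing.Zmodule_isLmodule.Build K lmod_quot
  lmod_quot_scalerA lmod_quot_scale1r lmod_quot_scalerDr lmod_quot_scalerDl.

Fact pi_lmod_quot_linear : linear (\pi_lmod_quot : V -> lmod_quot).
Proof. by move=> a x y; rewrite lmod_quotD lmod_quotZ. Qed.

End QuotientModule.

Record simplicial_complex (V : choiceType) := SimplicialComplex {
  simplices : set {fset V};
  simplex_neq0 : forall s, simplices s -> s != fset0;
  simplex_face : forall s t, simplices s -> (t `<=` s)%fset -> t != fset0 ->
    simplices t
}.

Section Chains.
Context (k : fieldType) (V : choiceType) (K : simplicial_complex V).

Definition permute_tuple n (s : 'S_n) (t : n.-tuple V) : n.-tuple V :=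
  [tuple tnth t (s i) | i < n].

Definition spans_simplex n (t : n.-tuple V) : Prop :=
  uniq t /\ simplices K [fset x in (t : seq V)]%fset.

(* Oriented chains: a function on the orderings (v_0, ..., v_n) of the        *)
(* n-simplices (extended by 0 to the other tuples), with finite support, that *)
(* changes by the sign of the permutation when the vertices are permuted.     *)
Definition is_chain n (c : n.+1.-tuple V -> k^o) : Prop :=
  [/\ finite_set [set t | c t != 0],
      forall t, c t != 0 -> spans_simplex t
    & forall (s : 'S_n.+1) t, c (permute_tuple s t) = (-1) ^+ s * c t].

Definition chain_pred n : {pred n.+1.-tuple V -> k^o} :=
  fun c => `[< is_chain c >].

Fact chain_pred_submod n : submod_closed (@chain_pred n).
Proof.
split.
  apply/asboolP; split=> [|t|s t]; rewrite ?eqxx ?mulr0//.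
  by apply: (sub_finite_set (B := set0)) => // t /=; rewrite eqxx.
move=> a c d /asboolP[finc Kc altc] /asboolP[find Kd altd].
apply/asboolP.
have supp t : (a *: c + d) t != 0 -> c t != 0 \/ d t != 0.
  rewrite !fctE; have [->|] := eqVneq (c t) 0; last by left.
  by rewrite scaler0 add0r; right.
split=> [|t /supp[/Kc|/Kd]//|s t].
- by apply: (sub_finite_set supp); rewrite -/(setU _ _) finite_setU.
- by rewrite !fctE altc altd /GRing.scale/= mulrDr mulrCA.
Qed.

HB.instance Definition _ n :=
  GRing.isSubmodClosed.Build k (n.+1.-tuple V -> k^o) (@chain_pred n)
    (@chain_pred_submod n).

Record chain n := Chain {
  chain_fun :> n.+1.-tuple V -> k^o;
  _ : chain_fun \in @chain_pred n
}.

HB.instance Definition _ n := [isSub for @chain_fun n].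
HB.instance Definition _ n := [Choice of chain n by <:].
HB.instance Definition _ n := [SubChoice_isSubLmodule of chain n by <:].

Lemma chainP n (c : chain n) : is_chain c.
Proof. by case: c => c /= /asboolP. Qed.

(* The boundary operator on coefficients: a simplex w receives the            *)
(* coefficients of all the oriented simplices v :: w. The lemma               *)
(* boundary_oriented below recovers the usual formula                         *)
(*   d [v_0, ..., v_(n+1)] = \sum_i (-1)^i [v_0, .., (omit v_i), .., v_(n+1)] *)
Definition boundary_fun n (c : n.+2.-tuple V -> k^o) (w : n.+1.-tuple V) : k^o :=
  \sum_(v \in [set: V]) c (cons_tuple v w).

Lemma support_vertices n (c : n.-tuple V -> k^o) :
  finite_set [set t | c t != 0] ->
  exists S : {fset V}, forall t, c t != 0 -> {subset (t : seq V) <= S}.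
Proof.
move=> fin; pose r := flatten (map (@tval n V) (fset_set [set t | c t != 0])).
exists [fset x in r]%fset => t ct x xt; rewrite inE/=.
by apply/flatten_mapP; exists t => //; rewrite in_fset_set// inE.
Qed.

Lemma boundary_funE n (c : n.+2.-tuple V -> k^o) (S : {fset V}) w :
  (forall t, c t != 0 -> {subset (t : seq V) <= S}) ->
  boundary_fun c w = \sum_(v <- S) c (cons_tuple v w).
Proof.
move=> cS; apply: fsbigTE => v; apply: contraNeq => /cS; apply.
by rewrite inE eqxx.
Qed.

Lemma cons_permute_tuple n (s : 'S_n) v (w : n.-tuple V) :
  cons_tuple v (permute_tuple s w) =
  permute_tuple (lift_perm ord0 ord0 s) (cons_tuple v w).
Proof.
apply: eq_from_tnth => i; rewrite [RHS]tnth_mktuple.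
case: (unliftP ord0 i) => [j|] ->.
  by rewrite lift_perm_lift !tnthS tnth_mktuple.
by rewrite lift_perm_id !tnth0.
Qed.

Lemma boundary_is_chain n (c : n.+2.-tuple V -> k^o) :
  is_chain c -> is_chain (boundary_fun c).
Proof.
case=> finc Kc altc.
have supp w : boundary_fun c w != 0 -> exists v, c (cons_tuple v w) != 0.
  by move=> /(fsbigN1 (f := fun w v => c (cons_tuple v w)))[v _ cv]; exists v.
split=> [|w /supp[v /Kc[/= /andP[_ uw] Kvw]]|s w].
- apply: sub_finite_set (finite_image (@behead_tuple _ V) finc) => w.
  by move=> /supp[v cv]; exists (cons_tuple v w) => //; exact/val_inj.
- split=> //; apply: simplex_face Kvw _ _.
    by apply/fsubsetP => x; rewrite !inE => ->; rewrite orbT.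
  by apply/fset0Pn; exists (thead w); rewrite inE mem_tnth.
- have [S cS] := support_vertices finc.
  rewrite !(boundary_funE _ cS) mulr_sumr; apply: eq_bigr => v _.
  by rewrite cons_permute_tuple altc odd_lift_perm.
Qed.

Fact boundary_chain_pred n (c : chain n.+1) :
  boundary_fun c \in @chain_pred n.
Proof. exact/asboolP/boundary_is_chain/chainP. Qed.

Definition boundary n (c : chain n.+1) : chain n :=
  Chain (boundary_chain_pred c).

Fact boundary_linear n : linear (@boundary n).
Proof.
move=> a c d; apply/val_inj/funext => w.
rewrite [RHS]/= !fctE/=.
have [finc _ _] := chainP c; have [find _ _] := chainP d.
have [S cS] := support_vertices finc.
have [T dT] := support_vertices find.
have cU t : c t != 0 -> {subset (t : seq V) <= S `|` T}%fset.
  by move=> /cS ct x /ct; rewrite inE => ->.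
have dU t : d t != 0 -> {subset (t : seq V) <= S `|` T}%fset.
  by move=> /dT dt x /dt; rewrite inE orbC => ->.
rewrite (boundary_funE _ cU) (boundary_funE _ dU) scaler_sumr -big_split.
apply: boundary_funE => t /=.
rewrite !fctE; have [->|/cU//] := eqVneq (c t) 0.
by rewrite scaler0 add0r => /dU.
Qed.

HB.instance Definition _ n :=
  GRing.isLinear.Build k (chain n.+1) (chain n) _ (@boundary n)
    (@boundary_linear n).

(* The oriented simplex [v_0, ..., v_n] as a chain.                           *)
Definition oriented_fun n (t : n.+1.-tuple V) : n.+1.-tuple V -> k^o :=
  fun w => \sum_(s : 'S_n.+1) (if w == permute_tuple s t then (-1) ^+ s else 0).

Definition omit_vertex n (i : 'I_n.+1) (t : n.+1.-tuple V) : n.-tuple V :=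
  [tuple tnth t (lift i j) | j < n].

Lemma permute_tupleM n (s u : 'S_n) (t : n.-tuple V) :
  permute_tuple s (permute_tuple u t) = permute_tuple (s * u)%g t.
Proof. by apply: eq_from_tnth => i; rewrite !tnth_mktuple permM. Qed.

Lemma permute_tuple1 n (t : n.-tuple V) : permute_tuple 1%g t = t.
Proof. by apply: eq_from_tnth => i; rewrite tnth_mktuple perm1. Qed.

Lemma mem_permute_tuple n (s : 'S_n) (t : n.-tuple V) :
  permute_tuple s t =i t.
Proof.
move=> x; apply/tnthP/tnthP => -[i ->].
  by exists (s i); rewrite tnth_mktuple.
by exists ((s^-1)%g i); rewrite tnth_mktuple permKV.
Qed.

Lemma oriented_is_chain n (t : n.+1.-tuple V) :
  spans_simplex t -> is_chain (oriented_fun t).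
Proof.
move=> [ut Kt].
have supp w : oriented_fun t w != 0 -> exists s, w = permute_tuple s t.
  move=> w0; apply: contrapT => /forallNP Nw; move/eqP: w0; apply.
  by rewrite /oriented_fun big1// => s _; case: eqP => // /Nw.
split=> [|w /supp[s ->]|s w].
- apply: (sub_finite_set (B := range (fun s : 'S_n.+1 => permute_tuple s t))).
    by move=> w /supp[s ->]; exists s.
  exact/finite_image/finite_finset.
- split.
    rewrite (_ : uniq _ = uniq t)//; apply/esym/eq_uniq.
      by rewrite !size_tuple.
    by move=> x; rewrite mem_permute_tuple.
  rewrite (_ : [fset _ | _ in _]%fset = [fset x in (t : seq V)]%fset)//.
  by apply/fsetP => x; rewrite !inE mem_permute_tuple.
- rewrite /oriented_fun (reindex_inj (mulgI s)) mulr_sumr.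
  apply: eq_bigr => u _; rewrite -permute_tupleM.
  have -> : (permute_tuple s w == permute_tuple s (permute_tuple u t)) =
            (w == permute_tuple u t).
    apply/eqP/eqP => [|->//].
    move/(congr1 (permute_tuple s^-1)); rewrite !permute_tupleM mulVg.
    by rewrite mul1g permute_tuple1.
  by case: eqP => _; rewrite ?mulr0// odd_permM signr_addb.
Qed.

Lemma boundary_oriented n (t : n.+2.-tuple V) :
  boundary_fun (oriented_fun t) =
  \sum_(i < n.+2) (-1) ^+ i *: oriented_fun (omit_vertex i t).
Proof.
apply/funext => w; rewrite fct_sumE.
have supp u : oriented_fun t u != 0 ->
    {subset (u : seq V) <= [fset x in (t : seq V)]%fset}.
  move=> u0 x xu; rewrite inE/=; apply: contraNT u0 => xt.
  rewrite /oriented_fun big1// => s _; case: eqP => // ust.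
  by move: xt; rewrite -(mem_permute_tuple s) -ust xu.
rewrite (boundary_funE _ supp) /oriented_fun exchange_big/=.
rewrite (partition_big (fun s : 'S_n.+2 => s ord0) predT)//=.
apply: eq_bigr => i _.
rewrite fctE/= scaler_sumr (reindex (lift_perm ord0 i)); last first.
  pose ulsf (s : 'S_n.+2) j := odflt j (unlift (s ord0) (s (lift ord0 j))).
  have ulsfK (s : 'S_n.+2) j :
      lift (s ord0) (ulsf s j) = s (lift ord0 j).
    rewrite /ulsf; have := neq_lift ord0 j.
    by rewrite -(can_eq (permK s)) => /unlift_some[] ? ? ->.
  have inj_ulsf (s : 'S_n.+2) : injective (ulsf s).
    move=> j j' /(congr1 (lift (s ord0))); rewrite !ulsfK.
    by move=> /perm_inj/lift_inj.
  exists (fun s => perm (inj_ulsf s)) => [s _|s /eqP si].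
    apply/permP => j; rewrite permE; apply: (@lift_inj _ i).
    by have := ulsfK (lift_perm ord0 i s) j; rewrite lift_perm_lift lift_perm_id.
  apply/permP => j; case: (unliftP ord0 j) => [j'|] ->.
    by rewrite lift_perm_lift permE -[in LHS]si ulsfK.
  by rewrite lift_perm_id si.
rewrite (eq_bigl predT); last by move=> s; rewrite lift_perm_id eqxx.
apply: eq_bigr => s _.
have it : tnth t i \in [fset x in (t : seq V)]%fset by rewrite inE/= mem_tnth.
rewrite (bigD1_seq (tnth t i))//= big1 ?addr0 => [|v vi].
  have -> : permute_tuple (lift_perm ord0 i s) t =
            cons_tuple (tnth t i) (permute_tuple s (omit_vertex i t)).
    apply: eq_from_tnth => j; rewrite tnth_mktuple.
    case: (unliftP ord0 j) => [j'|] ->.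
      by rewrite lift_perm_lift tnthS !tnth_mktuple.
    by rewrite lift_perm_id tnth0.
  rewrite -!val_eqE/= eqseq_cons eqxx/=.
  by case: ifP => _; rewrite ?scaler0// odd_lift_perm/= signr_addb signr_odd.
case: eqP => // /(congr1 (fun u => tnth u ord0)).
by rewrite tnth0 tnth_mktuple lift_perm_id => vE; rewrite vE eqxx in vi.
Qed.

Lemma sum_alternating (s : seq V) (f : V -> V -> k) :
  (forall u v, f u v = - f v u) -> (forall u, f u u = 0) ->
  \sum_(u <- s) \sum_(v <- s) f u v = 0.
Proof.
move=> fN f0; elim: s => [|x s IH]; first by rewrite big_nil.
rewrite big_cons big_cons f0 add0r.
under [X in _ + X]eq_bigr do rewrite big_cons.
rewrite big_split/= IH addr0 -big_split big1//= => u _.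
by rewrite [X in X + _]fN addNr.
Qed.

Lemma boundary_boundary n (c : chain n.+2) : boundary (boundary c) = 0.
Proof.
apply/val_inj/funext => w /=.
have [finc Kc altc] := chainP c.
have [S cS] := support_vertices finc.
have bS t : boundary_fun c t != 0 -> {subset (t : seq V) <= S}.
  move=> /(fsbigN1 (f := fun w v => c (cons_tuple v w)))[v _ /cS ct] x xt.
  by apply: ct; rewrite inE xt orbT.
rewrite (boundary_funE _ bS).
under eq_bigr do rewrite (boundary_funE _ cS).
apply: sum_alternating => u; last first.
  apply/eqP; apply: contraT => /Kc[/= /andP[+ _] _].
  by rewrite inE eqxx.
move=> v; set o1 := lift ord0 ord0 : 'I_n.+3.
rewrite (_ : cons_tuple v _ =
  permute_tuple (tperm ord0 o1) (cons_tuple u (cons_tuple v w))).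
  by rewrite altc odd_tperm expr1 mulN1r.
apply: eq_from_tnth => i; rewrite tnth_mktuple.
case: (unliftP ord0 i) => [j|] ->; last by rewrite tpermL tnthS !tnth0.
case: (unliftP ord0 j) => [j'|] ->; last by rewrite tpermR tnthS !tnth0.
by rewrite tpermD// !tnthS.
Qed.

End Chains.

Section Homology.
Context (k : fieldType) (V : choiceType) (K : simplicial_complex V).

Definition cycle_pred n : {pred chain k K n} :=
  match n with
  | 0%N => predT
  | _.+1 => fun c => boundary c == 0
  end.

Fact cycle_pred_submod n : submod_closed (@cycle_pred n).
Proof.
case: n => [//|n]; split; first by rewrite unfold_in /= linear0.
move=> a c d; rewrite !unfold_in /= => /eqP c0 /eqP d0.
by rewrite linearP/= c0 d0 scaler0 addr0.
Qed.

HB.instance Definition _ n :=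
  GRing.isSubmodClosed.Build k (chain k K n) (@cycle_pred n)
    (@cycle_pred_submod n).

Record cycle n := Cycle {
  cycle_chain :> chain k K n;
  _ : cycle_chain \in @cycle_pred n
}.

HB.instance Definition _ n := [isSub for @cycle_chain n].
HB.instance Definition _ n := [Choice of cycle n by <:].
HB.instance Definition _ n := [SubChoice_isSubLmodule of cycle n by <:].

Definition boundary_pred n : {pred cycle n} :=
  fun z => `[< exists b : chain k K n.+1, boundary b = z >].

Fact boundary_pred_submod n : submod_closed (@boundary_pred n).
Proof.
split; first by apply/asboolP; exists 0; rewrite linear0.
move=> a y z /asboolP[b by_] /asboolP[c cz]; apply/asboolP.
by exists (a *: b + c); rewrite linearP/= by_ cz.
Qed.

HB.instance Definition _ n :=
  GRing.isSubmodClosed.Build k (cycle n) (@boundary_pred n)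
    (@boundary_pred_submod n).

(* Non-reduced homology: every 0-chain is a cycle.                            *)
Definition homology n : lmodType k := lmod_quot (@boundary_pred n).

End Homology.

Section VietorisRips.
Context (R : realType) (X : metricType R).

Definition totally_bounded : Prop :=
  forall e : R, 0 < e ->
    exists F : {fset X}, forall x : X, exists2 y : X, y \in F & mdist x y < e.

Definition rips_simplices (a : R) : set {fset X} :=
  [set s | s != fset0 /\ forall x y, x \in s -> y \in s -> mdist x y < a].

Fact rips_simplex_neq0 a s : rips_simplices a s -> s != fset0.
Proof. by case. Qed.

Fact rips_simplex_face a s t :
  rips_simplices a s -> (t `<=` s)%fset -> t != fset0 -> rips_simplices a t.
Proof.
move=> [_ sa] /fsubsetP ts t0; split=> // x y /ts xs /ts ys.
exact: sa.
Qed.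

(* Rips(X, a^-), with the strict inequality.                                  *)
Definition open_rips (a : R) : simplicial_complex X :=
  SimplicialComplex (@rips_simplex_neq0 a) (@rips_simplex_face a).

End VietorisRips.

Arguments totally_bounded {R} X.
Arguments open_rips {R} X a.

(* Main.v *)
From HB Require Import structures.
From mathcomp Require Import all_boot all_order fingroup perm all_algebra.
From mathcomp Require Import finmap ring lra.
From mathcomp Require Import all_classical reals topology generic_quotient.
Require Import Defs.

Import Order.TTheory GRing.Theory Num.Theory.

Local Open Scope ring_scope.
Local Open Scope quotient_scope.

(** The space consists of two sequences x_0, x_1, ... and y_0, y_1, ... (the
    two sides of a ladder), with r_n := a / (n + 3) and
      d(x_i, x_j) = d(y_i, y_j) = r_i + r_j   for i != j,
      d(x_i, y_i) = a - r_i,   and   d(x_i, y_j) = a   for i != j.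
    Moving along a side from index i to another index costs at least r_i,
    which is exactly what the rung x_i y_i saves over the distance a; this
    gives the triangle inequality. As r_n tends to 0, each side is a Cauchy
    sequence, so the space is totally bounded.

    At scale a, with strict inequality, each side spans a full simplex, and
    the only edges between the sides are the rungs x_i y_i. The Rips complex
    is therefore two contractible pieces joined by infinitely many disjoint
    arcs. Algebraically: no triangle contains a rung, so the coefficient of a
    1-cycle at a rung vanishes on boundaries ([boundary_free_edge]) and yields
    a linear form on H_1. The cycles running around rung 0 and rung i + 1 are
    dual to the forms at the rungs i + 1 ([ladder_chain_coef]), and a space
    carrying an infinite biorthogonal system is not finite-dimensional
    ([infinite_dimensional_quot]).

    All this uses only the combinatorics of the complex, and is stated for any
    simplicial complex that contains such a ladder
    ([infinite_dimensional_ladder]). *)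

(** * Biorthogonal systems in a quotient space *)

(** If n classes generated the quotient, the identity matrix of size n + 1,
    made of the values f_i(z_j), would factor through dimension n. *)
Lemma infinite_dimensional_quot (K : fieldType) (V : lmodType K)
    (I : submodClosed V) (z : nat -> V) (f : nat -> {linear V -> K^o}) :
    (forall i x, x \in I -> f i x = 0) ->
    (forall i j, f i (z j) = (i == j)%:R) ->
  infinite_dimensional (lmod_quot I).
Proof.
move=> f0 fz [n [e egen]].
have /choice[A zA] (j : nat) : exists b : 'I_n -> K,
    forall i, f i (z j) = \sum_(l < n) b l * f i (repr (e l)).
  have [b zb] := egen (\pi_(lmod_quot I) (z j)); exists b => i.
  have /eqP := zb.
  under [X in _ == X]eq_bigr => l _ do rewrite -(reprK (e l)).
  have -> : \sum_(l < n) b l *: \pi_(lmod_quot I) (repr (e l)) =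
            \pi_(lmod_quot I) (\sum_(l < n) b l *: repr (e l)).
    elim/big_ind2 : _ => [|p u q v -> ->|l _].
    - by rewrite -[X in \pi X](scale0r (0 : V)) lmod_quotZ; exact/esym/scale0r.
    - by rewrite lmod_quotD.
    - by rewrite lmod_quotZ.
  rewrite lmod_quot_eq => /(f0 i)/eqP; rewrite linearB subr_eq0 => /eqP ->.
  by rewrite linear_sum; apply: eq_bigr => l _; rewrite linearZ.
have : \matrix_(j < n.+1, l < n) A j l *m
       \matrix_(l < n, i < n.+1) f i (repr (e l)) = 1%:M.
  apply/matrixP => j i; rewrite !mxE.
  under eq_bigr do rewrite !mxE.
  by rewrite -zA fz eq_sym.
by move=> /mulmx1_min; rewrite ltnn.
Qed.

(** * Oriented simplices and their coefficients *)

Section OrientedSimplices.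
Context {k : fieldType} {V : choiceType} {K : simplicial_complex V}.

Lemma oriented_fun_id n (t : n.+1.-tuple V) : uniq t -> oriented_fun k t t = 1.
Proof.
move=> ut; rewrite /oriented_fun (bigD1 (1%g : 'S_n.+1))//= permute_tuple1 eqxx odd_perm1.
rewrite big1 ?addr0// => s s1; case: eqP => // tE.
case/eqP: s1; apply/permP => i; rewrite perm1.
have := congr1 (fun u => tnth u i) tE; rewrite tnth_mktuple.
by move/tuple_uniqP: ut => /[apply].
Qed.

Lemma oriented_fun_notin n (t w : n.+1.-tuple V) v :
  v \in w -> v \notin t -> oriented_fun k t w = 0.
Proof.
move=> vw vt; rewrite /oriented_fun big1// => s _; case: eqP => // wE.
by move: vt; rewrite -(mem_permute_tuple s) -wE vw.
Qed.

Definition oriented_chain {n} {t : n.+1.-tuple V} (tK : spans_simplex K t) :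
  chain k K n := Chain (asboolT (oriented_is_chain k tK)).

Lemma boundary_edge (u v : V) :
  boundary_fun (oriented_fun k [tuple u; v]) =
  oriented_fun k [tuple v] - oriented_fun k [tuple u].
Proof.
rewrite boundary_oriented big_ord_recl big_ord1 expr0 scale1r expr1 scaleN1r.
by congr (oriented_fun k _ - oriented_fun k _); apply: eq_from_tnth => i;
  rewrite tnth_mktuple !ord1.
Qed.

(** The coefficient of a boundary at an edge only involves the triangles that
    contain this edge. *)
Lemma boundary_free_edge (b : chain k K 2) (u v : V) :
  (forall w, ~ spans_simplex K [tuple w; u; v]) -> boundary b [tuple u; v] = 0.
Proof.
move=> free; apply: fsbig1 => w _; apply/eqP; apply: contraT.
have [_ bK _] := chainP b => /bK; rewrite (_ : cons_tuple _ _ = [tuple w; u; v]).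
  by move/free.
exact: val_inj.
Qed.

End OrientedSimplices.

(** * Complexes containing a ladder *)

Section Ladder.
Context (k : fieldType) (V : choiceType) (K : simplicial_complex V).
Variables (x y : nat -> V).
Hypothesis xxK : forall i j, i != j -> spans_simplex K [tuple x i; x j].
Hypothesis yyK : forall i j, i != j -> spans_simplex K [tuple y i; y j].
Hypothesis xyK : forall i, spans_simplex K [tuple x i; y i].
Hypothesis xy_neq : forall i j, x i != y j.
Hypothesis rung_free : forall i w, ~ spans_simplex K [tuple w; x i; y i].

(** The square x_0 -> x_(i+1) -> y_(i+1) -> y_0 -> x_0. *)
Definition ladder_chain i : chain k K 1 :=
  oriented_chain (xxK 0 i.+1 isT) + oriented_chain (xyK i.+1)
  - oriented_chain (yyK 0 i.+1 isT) - oriented_chain (xyK 0).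

Lemma boundary_ladder_chain i : boundary (ladder_chain i) = 0.
Proof.
rewrite /ladder_chain !linearB/= linearD/=; apply/val_inj => /=.
rewrite !boundary_edge; apply/funext => w; rewrite !fctE.
by transitivity (0 : k); [ring|].
Qed.

(** Among the four edges of the square, only the rung i + 1 can be a rung of
    positive index; rung 0, common to all the squares, is not tested. *)
Lemma ladder_chain_coef i j :
  ladder_chain j [tuple x i.+1; y i.+1] = (i == j)%:R.
Proof.
have xI p q : p != q -> x p != x q.
  by move=> /xxK[/= /andP[+ _] _]; rewrite inE.
have off_rung p q : p != q ->
    oriented_fun k [tuple x p; y p] [tuple x q; y q] = 0.
  move=> pq; apply: (oriented_fun_notin _ _ _ (x q)); rewrite !inE ?eqxx//.
  by rewrite negb_or xy_neq xI// eq_sym.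
rewrite /= !fctE/= (oriented_fun_notin _ [tuple y 0; _] _ (x i.+1)); last 2 first.
- by rewrite !inE eqxx.
- by rewrite !inE negb_or !xy_neq.
rewrite (oriented_fun_notin _ [tuple x 0; _] _ (y i.+1)); last 2 first.
- by rewrite !inE eqxx orbT.
- by rewrite !inE negb_or ![y _ == _]eq_sym !xy_neq.
rewrite (off_rung 0%N)// add0r !subr0; have [->|ij] := eqVneq i j.
  by rewrite oriented_fun_id//; case: (xyK j.+1).
by rewrite off_rung// eqSS eq_sym.
Qed.

Definition rung_coef i (z : cycle k K 1) : k^o :=
  cycle_chain z [tuple x i.+1; y i.+1].

Fact rung_coef_linear i : linear (rung_coef i).
Proof. by []. Qed.

HB.instance Definition _ i :=
  GRing.isLinear.Build k (cycle k K 1) k^o _ (rung_coef i) (rung_coef_linear i).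

Lemma infinite_dimensional_ladder : infinite_dimensional (homology k K 1).
Proof.
have zP i : ladder_chain i \in cycle_pred (n := 1).
  by apply/eqP/boundary_ladder_chain.
apply: (infinite_dimensional_quot _ _ _ (fun i => Cycle (zP i)) rung_coef).
- move=> i z /asboolP[b bz]; rewrite /= /rung_coef -bz.
  exact/boundary_free_edge/rung_free.
- exact: ladder_chain_coef.
Qed.

End Ladder.

(** * The ladder as a metric space *)

Lemma spans_rips_edge (R : realType) (X : metricType R) (a : R) (u v : X) :
  0 < a -> u != v -> mdist u v < a -> spans_simplex (open_rips X a) [tuple u; v].
Proof.
move=> a0 uv uva; split; first by rewrite /= inE uv.
split=> [|p q]; first by apply/fset0Pn; exists u; rewrite !inE eqxx.
by rewrite !inE !orbF => /orP[] /eqP-> /orP[] /eqP->;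
  rewrite ?mdistxx// metric_sym.
Qed.

Section LadderSpace.
Context (R : realType) (a : R).

(** The points (true, n) and (false, n) are x_n and y_n. The scale and its
    positivity are parameters of the type so that the metric, which depends
    on them, can be attached to it. *)
Definition ladder_space (a_gt0 : 0 < a) : Type := bool * nat.

Context (a_gt0 : 0 < a).
Local Notation X := (ladder_space a_gt0).

HB.instance Definition _ := Choice.on X.

(** Any positive sequence tending to 0 and bounded by some c < a / 2 would do:
    this bound keeps the diameter of each side below a. *)
Definition gap (n : nat) : R := a / n.+3%:R.

Lemma gap_gt0 n : 0 < gap n.
Proof. by rewrite divr_gt0. Qed.

Lemma gap_le_third n : gap n <= a / 3.
Proof. by rewrite /gap ler_pM2l// lef_pV2// ?posrE// ler_nat. Qed.

Definition ladder_dist (p q : X) : R :=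
  if p.1 == q.1 then (if p.2 == q.2 then 0 else gap p.2 + gap q.2)
  else (if p.2 == q.2 then a - gap p.2 else a).

Fact ladder_distxx p : ladder_dist p p = 0.
Proof. by rewrite /ladder_dist !eqxx. Qed.

Fact ladder_dist_positivity p q : ladder_dist p q = 0 -> p = q.
Proof.
case: p q => [s i] [t j]; rewrite /ladder_dist/=.
have := gap_gt0 i; have := gap_gt0 j; have := gap_le_third i.
case: eqVneq => [->|_]; case: eqVneq => [->|_]// *; exfalso; lra.
Qed.

Fact ladder_dist_sym p q : ladder_dist p q = ladder_dist q p.
Proof.
case: p q => [s i] [t j]; rewrite /ladder_dist/= (eq_sym t) (eq_sym j).
by have [<-|_] := eqVneq i j; case: (s == t) => //; rewrite addrC.
Qed.

Fact ladder_dist_triangle q p r :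
  ladder_dist p r <= ladder_dist p q + ladder_dist q r.
Proof.
case: p q r => [s i] [t j] [u l]; rewrite /ladder_dist/=.
have := gap_gt0 i; have := gap_gt0 j; have := gap_gt0 l.
have := gap_le_third i; have := gap_le_third j; have := gap_le_third l.
case: s t u => [] [] [] /=;
  case: (eqVneq i l) => [<-|il]; case: (eqVneq i j) => [<-|_];
  rewrite ?eqxx ?(negPf il); try case: (eqVneq j l) => [<-|_]; lra.
Qed.

HB.instance Definition _ := @isMetric.Build R X ladder_dist ladder_distxx
  ladder_dist_positivity ladder_dist_sym ladder_dist_triangle.

Lemma mdist_ladderE (p q : X) : mdist p q = ladder_dist p q.
Proof. by []. Qed.

Lemma ler_gap m n : (m <= n)%N -> gap n <= gap m.
Proof.
by move=> mn; rewrite /gap ler_pM2l// lef_pV2// ?posrE// ler_nat !ltnS.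
Qed.

(** As both sides are Cauchy, finitely many initial points on each of them are
    dense enough: beyond index N, a point is close to the N-th of its side. *)
Lemma totally_bounded_ladder : totally_bounded X.
Proof.
move=> e e0.
have [N Ne] : exists N, gap N < e / 2.
  exists (Num.bound (a / (e / 2))).
  rewrite /gap ltr_pdivrMr// mulrC -ltr_pdivrMr ?divr_gt0//.
  have a0 : 0 <= a / (e / 2) by rewrite !divr_ge0// ltW.
  by rewrite (lt_le_trans (archi_boundP a0))// ler_nat -addn3 leq_addr.
have [heads in_heads] : exists heads : seq X,
    forall s n, (n <= N)%N -> (s, n) \in heads.
  exists (allpairs pair [:: true; false] (iota 0 N.+1)) => s n nN.
  by apply: allpairs_f; rewrite ?mem_iota//; case: s.
exists [fset p in heads]%fset => -[s i]; exists (s, minn i N).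
  by rewrite inE/= in_heads// geq_minr.
rewrite mdist_ladderE /ladder_dist/= eqxx.
have [_|iN] := leqP i N; first by rewrite eqxx.
by case: ifP => // _; have := ler_gap _ _ (ltnW iN); lra.
Qed.

Lemma rips_ladder_infinite_dimensional (k : fieldType) :
  infinite_dimensional (homology k (open_rips X a) 1).
Proof.
have close i j : gap i + gap j < a.
  by have := a_gt0; have := gap_le_third i; have := gap_le_third j; lra.
apply: (@infinite_dimensional_ladder _ _ _
  (fun i => (true, i) : X) (fun i => (false, i) : X)).
- move=> i j ij; apply: spans_rips_edge => //.
  by rewrite mdist_ladderE /ladder_dist/= (negPf ij) close.
- move=> i j ij; apply: spans_rips_edge => //.
  by rewrite mdist_ladderE /ladder_dist/= (negPf ij) close.
- move=> i; apply: spans_rips_edge => //.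
  by rewrite mdist_ladderE /ladder_dist/= eqxx ltrBlDr ltrDl gap_gt0.
- by [].
- move=> i [s j] [/= /andP[+ _] [_ near]]; rewrite !inE.
  (* A third vertex of index j != i is at distance a from the end of the rung
     that lies on the opposite side. *)
  have [->|ji] := eqVneq j i; first by case: (s); rewrite eqxx ?orbT.
  have := near (s, j) (~~ s, i).
  rewrite !inE eqxx mdist_ladderE /ladder_dist/= (negPf ji).
  by case: (s); rewrite /= !eqxx ?orbT ltxx => /(_ isT isT).
Qed.

End LadderSpace.

Theorem proposition5p11 (R : realType) (k : fieldType) (a : R) (a_gt0 : 0 < a) :
  exists X : metricType R,
    totally_bounded X /\ infinite_dimensional (homology k (open_rips X a) 1%N).
Proof.
exists (ladder_space R a a_gt0); split; first exact: totally_bounded_ladder.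
exact: rips_ladder_infinite_dimensional.
Qed.
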